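(* Let $G$ be an undirected graph with vertex set $\{1,\dots,n\}$, without loops (multiple edges are allowed), and assume that $G$ has no isolated vertices. Then the number $d(G)$ of orientations of $G$ without sources and sinks (i.e. such that every vertex has at least one incoming and at least one outgoing edge) is $$d(G)=\sum_{m=0}^n(-1)^m\sum_{\substack{P\subset\{1,\dots,n\}:\ \#P=m,\\ \langle P\rangle\text{ is bipartite}}}2^{\mu(P)+k(P)}.$$
   Context: An orientation of $G$ is a choice of direction for each edge (parallel edges are oriented independently). For $P\subset\{1,\dots,n\}$, $\langle P\rangle$ is the subgraph of $G$ with vertex set $P$ containing all edges of $G$ with both endpoints in $P$; $k(P)$ is the number of connected components of $\langle P\rangle$ (isolated vertices of $\langle P\rangle$ count as components); $\mu(P)$ is the number of edges of $G$ having both endpoints outside $P$. By convention $k(\emptyset)=0$, $\mu(\emptyset)$ is the total number of edges of $G$, and $\langle\emptyset\rangle$ is bipartite. *)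

(* Defs.v *)
From mathcomp Require Import all_boot all_order all_algebra.

Set Implicit Arguments.
Unset Strict Implicit.
Unset Printing Implicit Defensive.

(* Finite loopless undirected multigraphs on the n vertices 'I_n (standing for
   {1, ..., n}): edges have their own identity, so parallel edges are distinct
   elements of [edge] with the same set of endpoints, and loops are excluded
   because every edge has exactly two endpoints. *)
Record multigraph (n : nat) := Multigraph {
  edge : finType;
  ends : edge -> {set 'I_n};
  card_ends : forall e : edge, #|ends e| = 2
}.

Section Multigraph.

Variables (n : nat) (G : multigraph n).
Implicit Types (P A : {set 'I_n}) (v x y : 'I_n).

Definition no_isolated_vertex : Prop :=
  forall v, exists e : edge G, v \in ends e.

(* [o e = (x, y)] means that the edge e is directed from x to y. *)
Definition is_orientation (o : {ffun edge G -> 'I_n * 'I_n}) : bool :=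
  [forall e, ends e == [set (o e).1; (o e).2]].

Definition has_incoming (o : {ffun edge G -> 'I_n * 'I_n}) v : bool :=
  [exists e, (o e).2 == v].

Definition has_outgoing (o : {ffun edge G -> 'I_n * 'I_n}) v : bool :=
  [exists e, (o e).1 == v].

Definition d : nat :=
  #|[set o : {ffun edge G -> 'I_n * 'I_n} |
      is_orientation o && [forall v, has_incoming o v && has_outgoing o v]]|.

(* The induced subgraph <P> has vertex set P and this set of edges. *)
Definition induced_edges P : {set edge G} := [set e | ends e \subset P].

Definition induced_adj P : rel 'I_n :=
  [rel x y | [exists e in induced_edges P, ends e == [set x; y]]].

Definition induced_bipartite P : bool :=
  [exists A : {set 'I_n}, (A \subset P) &&
    [forall e in induced_edges P,
      [exists x in A, [exists y in P :\: A, ends e == [set x; y]]]]].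

(* [induced_adj P] only relates vertices of P, so P is closed under it, and
   [n_comp] counts the components of <P>, isolated vertices included. *)
Definition k P : nat := n_comp (induced_adj P) P.

Definition mu P : nat := #|[set e : edge G | ends e \subset ~: P]|.

End Multigraph.

(* Main.v *)
Require Import Defs.
From mathcomp Require Import all_boot all_order all_algebra.

(** The proof is inclusion-exclusion over the vertices that violate the
condition.  For an orientation [o], let [S] and [T] be its sets of sources and
of sinks.  The alternating sum of [(-1) ^+ #|P|] over the subsets [P] of
[S :|: T] is [1] if [S] and [T] are empty and [0] otherwise
([alternating_sum_subsets]), so [d G] is the sum over all [P] of [(-1) ^+ #|P|]
times the number of orientations in which every vertex of [P] is a source or a
sink.

Those orientations are counted by the set [A] of the sources that lie in [P].
No vertex is isolated, so no vertex is both a source and a sink, and the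
vertices of [P :\: A] are exactly the sinks that lie in [P].  Once [A] is fixed,
the edges are directed independently of each other: an edge inside [P] must go
from [A] to [P :\: A], an edge between [P] and its complement has a forced
direction, and an edge outside [P] is free.  There are thus [2 ^ mu G P]
orientations if [(A, P :\: A)] is a bipartition of the graph induced on [P], and
none otherwise ([card_constrained_orientations]).

Finally, two bipartitions of the same graph differ by a union of connected
components, and swapping the two sides on any union of components preserves
bipartitions; hence a bipartite induced graph has [2 ^ k G P] of them
([card_bipartitions]). *)

Set Implicit Arguments.
Unset Strict Implicit.
Unset Printing Implicit Defensive.

Import Order.TTheory GRing.Theory Num.Theory.
Local Open Scope ring_scope.

(** * Alternating sums and closed sets *)

(** Expand the product over [i] of [1 - (i \in B)], which vanishes as soon as
[B] has an element. *)
Lemma alternating_sum_subsets (T : finType) (B : {set T}) :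
  \sum_(P : {set T} | P \subset B) (-1) ^+ #|P| = (B == set0)%:R :> int.
Proof.
have :=
  bigA_distr (1 : int) +%R (fun i => - (i \in B)%:R) (fun=> 1).
have -> : \prod_i (- (i \in B)%:R + 1) = (B == set0)%:R :> int.
  have [-> | [x xB]] := set_0Vmem B.
    by rewrite eqxx big1 // => i _; rewrite in_set0 oppr0 add0r.
  have /negPf-> : B != set0 by apply/set0Pn; exists x.
  by rewrite (bigD1 x) //= xB addNr mul0r.
move=> ->; rewrite big_mkcond /=; apply: eq_bigr => P _.
rewrite -big_mkcond /= prodrN; case: ifPn => [/subsetP PB | /subsetPn[x xP xB]].
  by rewrite big1 ?mulr1 // => i /PB ->.
by rewrite (bigD1 x) //= (negPf xB) mul0r mulr0.
Qed.

Local Open Scope nat_scope.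

(** A closed subset of [P] is determined by the component roots it contains,
and any set of roots in [P] arises in this way. *)
Lemma card_closed_subsets (T : finType) (e : rel T) (P : {set T}) :
  connect_sym e -> closed e P ->
  #|[set C : {set T} | C \subset P & [forall x, forall y,
      e x y ==> ((x \in C) == (y \in C))]]| = 2 ^ n_comp e P.
Proof.
move=> symE clP; pose RP := [set x in P | roots e x].
have -> : n_comp e P = #|RP|.
  by apply: eq_card => x; rewrite !inE andbC.
rewrite -card_powerset; pose f (R : {set T}) := [set x in P | fingraph.root e x \in R].
have rootP x : (fingraph.root e x \in P) = (x \in P).
  by apply/esym/(closed_connect clP)/connect_root.
have f_inj : {in powerset RP &, injective f}.
  move=> R1 R2; rewrite !powersetE => /subsetP s1 /subsetP s2 /setP eqf.
  (* [R1] and [R2] consist of roots, and a root is its own image under [root]. *)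
  apply/setP => x; case: (boolP (x \in RP)) => [|xn]; last first.
    by rewrite (contraNF (s1 x) xn) (contraNF (s2 x) xn).
  by rewrite inE => /andP[xP /eqP rx]; move: (eqf x); rewrite !inE xP rx.
rewrite -(card_in_imset f_inj); apply: eq_card => C; rewrite inE.
apply/andP/imsetP => [[/subsetP CP /forallP clC] | [R _ ->]]; last first.
  split; first by apply/subsetP => x; rewrite inE => /andP[].
  apply/forallP => x; apply/forallP => y; apply/implyP => exy.
  by rewrite !inE (clP _ _ exy) (fingraph.rootP symE (connect1 exy)).
have clC' : closed e C.
  by move=> x y exy; move/forallP: (clC x) => /(_ y) /implyP /(_ exy) /eqP.
exists (C :&: RP); first by rewrite powersetE subsetIr.
apply/setP => x; rewrite !inE rootP roots_root // andbT.
rewrite -(closed_connect clC' (connect_root e x)).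
by case: (boolP (x \in C)) => [/CP -> | _]; rewrite ?andbF.
Qed.

(** * Bipartitions of induced subgraphs *)

Section Orientations.

Variables (n : nat) (G : multigraph n).
Implicit Types (P A B : {set 'I_n}) (e : edge G).
Implicit Types o : {ffun edge G -> 'I_n * 'I_n}.

Definition joins A B e : bool :=
  [exists x in A, [exists y in B, ends e == [set x; y]]].

Definition is_bipartition P A : bool :=
  (A \subset P) && [forall e in induced_edges G P, joins A (P :\: A) e].

Lemma ends_pair e : exists x y, x != y /\ ends e = [set x; y].
Proof. by apply/cards2P; rewrite card_ends. Qed.

Lemma eq_set2 (T : finType) (x y u v : T) : x != y ->
  ([set x; y] == [set u; v]) = ((u, v) == (x, y)) || ((u, v) == (y, x)).
Proof.
move=> xy; rewrite !xpair_eqE; apply/eqP/idP => [E | ]; last first.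
  by case/orP => /andP[/eqP-> /eqP->] //; rewrite setUC.
have: u \in [set x; y] by rewrite E set21.
have: v \in [set x; y] by rewrite E set22.
have: x \in [set u; v] by rewrite -E set21.
have: y \in [set u; v] by rewrite -E set22.
rewrite !inE => yuv xuv /orP[/eqP vE|/eqP vE] /orP[/eqP uE|/eqP uE].
- by move: yuv; rewrite uE vE orbb eq_sym (negPf xy).
- by rewrite uE vE !eqxx orbT.
- by rewrite uE vE !eqxx.
- by move: xuv; rewrite uE vE orbb (negPf xy).
Qed.

Lemma joinsE A B e x y : ends e = [set x; y] -> x != y ->
  joins A B e = (x \in A) && (y \in B) || (y \in A) && (x \in B).
Proof.
move=> eE xy; apply/existsP/idP => [[u /andP[uA /existsP[v /andP[vB]]]] | ].
  by rewrite eE eq_set2 // => /orP[] /eqP[<- <-]; rewrite uA vB ?orbT.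
case/orP => /andP[xA yB]; [exists x | exists y]; rewrite xA.
  by apply/existsP; exists y; rewrite yB eE eqxx.
by apply/existsP; exists x; rewrite yB eE setUC eqxx.
Qed.

Lemma is_bipartitionE P A : is_bipartition P A = (A \subset P) &&
  [forall x, forall y, induced_adj G P x y ==> ((x \in A) != (y \in A))].
Proof.
rewrite /is_bipartition; case: (boolP (A \subset P)) => //= AP.
apply/forallP/forallP => [bip x | alt e].
  apply/forallP => y; apply/implyP => /existsP[e /andP[eP /eqP eE]].
  have xy : x != y.
    by apply/eqP => xy; move: (card_ends e); rewrite eE xy setUid cards1.
  move/implyP: (bip e) => /(_ eP); rewrite (joinsE _ _ eE xy) !inE.
  by case: (x \in A); case: (y \in A).
apply/implyP => eP; have [x [y [xy eE]]] := ends_pair e.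
have: (x \in A) != (y \in A).
  move/forallP: (alt x) => /(_ y) /implyP; apply.
  by apply/existsP; exists e; rewrite eP eE eqxx.
move: eP; rewrite (joinsE _ _ eE xy) inE eE subUset !sub1set !inE.
by case/andP => -> ->; case: (x \in A); case: (y \in A).
Qed.

Lemma induced_adj_sym P : symmetric (induced_adj G P).
Proof. by move=> x y; apply: eq_existsb => e; rewrite setUC. Qed.

Lemma induced_adj_closed P : closed (induced_adj G P) P.
Proof.
move=> x y /existsP[e /andP[]]; rewrite inE => eP /eqP eE.
by move: eP; rewrite eE subUset !sub1set => /andP[-> ->].
Qed.

(** Symmetric difference with a fixed bipartition turns the sets that separate
the endpoints of every edge into those that separate the endpoints of none,
which are the unions of components. *)
Lemma card_bipartitions P :
  #|[set A | is_bipartition P A]| = induced_bipartite G P * 2 ^ k G P.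
Proof.
have -> : induced_bipartite G P = [exists A, is_bipartition P A] by [].
case: existsP => [[A0 bipA0] | nobip]; last first.
  by apply: eq_card0 => A; rewrite inE; apply/negP => bipA; case: nobip; exists A.
rewrite mul1n /k -card_closed_subsets; first last.
- exact: induced_adj_closed.
- exact/sym_connect_sym/induced_adj_sym.
pose f A := [set x | (x \in A) (+) (x \in A0)].
have fK : involutive f by move=> A; apply/setP => x; rewrite !inE addbK.
rewrite -(card_imset _ (inv_inj fK)); apply: eq_card => C.
rewrite -{1}[C]fK (mem_imset _ _ (inv_inj fK)) !inE is_bipartitionE.
move: bipA0; rewrite is_bipartitionE => /andP[/subsetP A0P /forallP altA0].
congr (_ && _).
  apply/subsetP/subsetP => sub x.
    move=> xC; case: (boolP (x \in A0)) => [/A0P // | xA0].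
    by apply: sub; rewrite inE xC (negPf xA0).
  by rewrite inE; case: (boolP (x \in A0)) => [/A0P //|_]; rewrite addbF => /sub.
apply: eq_forallb => x; apply: eq_forallb => y.
move/forallP: (altA0 x) => /(_ y); case: induced_adj => //=; rewrite !inE.
by do 4!case: (_ \in _).
Qed.

(** * Orientations with prescribed sources and sinks *)

Definition sources o : {set 'I_n} := [set v | ~~ has_incoming o v].

Definition sinks o : {set 'I_n} := [set v | ~~ has_outgoing o v].

(** The directions left to the edge [e] when [A] consists of sources and
[P :\: A] of sinks: every endpoint in [P] rules out one of the two directions, and
an edge inside [P] keeps one only if its endpoints rule out the same one. *)
Lemma card_edge_directions P A e : A \subset P ->
  #|[pred p : 'I_n * 'I_n | [&& ends e == [set p.1; p.2],
       p.2 \notin A & p.1 \notin P :\: A]]| =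
  if ends e \subset ~: P then 2
  else if ends e \subset P then joins A (P :\: A) e : nat else 1.
Proof.
move=> /subsetP AP; have [x [y [xy eE]]] := ends_pair e.
rewrite (joinsE _ _ eE xy) (cardD1 (x, y)) (cardD1 (y, x)) eq_card0; last first.
  move=> [u v]; rewrite !inE /= eE eq_set2 //.
  by case: eqP => //=; case: eqP.
rewrite !inE /= eE !eq_set2 // !eqxx orbT /= !xpair_eqE eq_sym (negPf xy) /=.
rewrite !subUset !sub1set !inE addn0.
by move/implyP: (AP x); move/implyP: (AP y); do 4!case: (_ \in _).
Qed.

(** The constraints concern each edge separately, so the set of orientations is
a product over the edges of the sets counted by [card_edge_directions]. *)
Lemma card_constrained_orientations P A : A \subset P ->
  #|[set o | [&& is_orientation o, A \subset sources o
                & P :\: A \subset sinks o]]| =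
  is_bipartition P A * 2 ^ mu G P.
Proof.
move=> AP; pose allowed e := [pred p : 'I_n * 'I_n |
  [&& ends e == [set p.1; p.2], p.2 \notin A & p.1 \notin P :\: A]].
have -> : #|[set o | [&& is_orientation o, A \subset sources o
                & P :\: A \subset sinks o]]| = \prod_e #|allowed e|.
  have := card_family allowed; rewrite foldrE big_image /= => <-.
  apply: eq_card => o; rewrite inE.
  apply/and3P/familyP => [[/forallP oP /subsetP So /subsetP To] e | al].
    rewrite !inE oP /=; apply/andP; split.
      by apply/negP => /So; rewrite inE => /existsP[]; exists e.
    by rewrite -in_setD; apply/negP => /To; rewrite inE => /existsP[]; exists e.
  split; first by apply/forallP => e; case/and3P: (al e).
    apply/subsetP => v vA; rewrite inE; apply/existsP => -[e /eqP ve].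
    by case/and3P: (al e) => _; rewrite ve vA.
  apply/subsetP => v vA; rewrite inE; apply/existsP => -[e /eqP ve].
  by case/and3P: (al e) => _ _; rewrite ve vA.
under eq_bigr => e _ do rewrite card_edge_directions //.
rewrite /is_bipartition AP /=.
case: (boolP [forall e in _, _]) => [/forallP bip | /forallPn[e]].
  rewrite mul1n /mu -sum1_card expn_sum big_mkcond [RHS]big_mkcond /=.
  apply: eq_bigr => e _; rewrite inE; case: ifP => // _.
  by move/implyP: (bip e); rewrite inE; case: ifP => // _ ->.
rewrite negb_imply inE => /andP[eP /negPf nj]; rewrite (bigD1 e) //= eP nj.
suff /negPf-> : ~~ (ends e \subset ~: P) by [].
have [x [y [_ eE]]] := ends_pair e; move: eP.
by rewrite eE !subUset !sub1set !inE => /andP[-> ->].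
Qed.

Hypothesis hG : no_isolated_vertex G.

Lemma disjoint_sources_sinks o : is_orientation o ->
  [disjoint sources o & sinks o].
Proof.
move=> /forallP oP; rewrite -setI_eq0; apply/eqP/setP => v; rewrite !inE.
apply/negP => /andP[/existsP nin /existsP nout]; have [e] := hG v.
rewrite (eqP (oP e)) !inE => /orP[] /eqP vE.
  by apply: nout; exists e; rewrite vE.
by apply: nin; exists e; rewrite vE.
Qed.

(** Group the orientations by the set [A] of the sources that lie in [P].
Sources and sinks being disjoint, [A] is this set exactly when [A] consists of
sources and [P :\: A] of sinks, so the groups do not overlap. *)
Lemma card_orientations_sources_sinks P :
  #|[set o | is_orientation o && (P \subset sources o :|: sinks o)]| =
  induced_bipartite G P * 2 ^ (mu G P + k G P).
Proof.
rewrite expnD mulnCA -card_bipartitions mulnC -sum1_card.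
rewrite (partition_big (fun o => P :&: sources o) (fun A => A \subset P)) /=;
  last by move=> o _; exact: subsetIl.
rewrite -sum_nat_const [RHS]big_mkcond [LHS]big_mkcond /=.
apply: eq_bigr => A _; rewrite inE; case: ifPn => AP; last first.
  by rewrite /is_bipartition (negPf AP).
rewrite sum1_card.
transitivity (is_bipartition P A * 2 ^ mu G P); last by case: ifP; rewrite ?mul1n.
rewrite -card_constrained_orientations //; apply: eq_card => o.
rewrite unfold_in /= !inE -andbA; case: (boolP (is_orientation o)) => //= oP.
move: (disjoint_sources_sinks oP); rewrite disjoint_subset => /subsetP dis.
move/subsetP: AP => AP.
apply/andP/andP => [[/subsetP PST /eqP <-] | [/subsetP AS /subsetP BT]].
  split; first exact: subsetIr.
  apply/subsetP => v; rewrite !in_setD !in_setI => /andP[+ vP].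
  by move: (PST v vP); rewrite vP in_setU => /orP[-> |].
split.
  apply/subsetP => v vP; rewrite in_setU.
  by case: (boolP (v \in A)) => [/AS -> // | vA]; rewrite BT ?orbT // in_setD vA.
apply/eqP/setP => v; rewrite in_setI; apply/andP/idP => [[vP vS] | vA].
  by apply: contraTT (dis v vS) => vA; rewrite negbK; apply: BT; rewrite in_setD vA.
by split; [exact: AP | exact: AS].
Qed.

End Orientations.

(** * Inclusion-exclusion *)

Local Open Scope ring_scope.

Theorem theorem8 (n : nat) (G : multigraph n) (hG : no_isolated_vertex G) :
  (d G)%:Z =
  \sum_(0 <= m < n.+1)
    (-1) ^+ m *
    \sum_(P : {set 'I_n} | (#|P| == m) && induced_bipartite G P)
      2%:Z ^+ (mu G P + k G P)%N.
Proof.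
pose bad (o : {ffun edge G -> 'I_n * 'I_n}) := sources o :|: sinks o.
transitivity (\sum_(P : {set 'I_n}) (-1) ^+ #|P| *
    (#|[set o : {ffun edge G -> 'I_n * 'I_n} |
         is_orientation o && (P \subset bad o)]|%:Z)).
  transitivity (\sum_(o : {ffun edge G -> 'I_n * 'I_n} | is_orientation o)
      \sum_(P : {set 'I_n} | P \subset bad o) (-1 : int) ^+ #|P|).
    rewrite /d -sum1_card -natz natr_sum big_mkcond [RHS]big_mkcond /=.
    apply: eq_bigr => o _; rewrite inE; case: is_orientation => //=.
    rewrite alternating_sum_subsets /bad.
    have -> : (sources o :|: sinks o == set0) =
        [forall v, has_incoming o v && has_outgoing o v].
      apply/eqP/forallP => [E v | allv].
        by move/setP: E => /(_ v); rewrite !inE -negb_and => /negbFE.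
      by apply/setP => v; rewrite !inE -negb_and allv.
    by case: [forall v, _].
  rewrite (exchange_big_dep xpredT) //=; apply: eq_bigr => P _.
  rewrite sumr_const -[in RHS]natz mulr_natr; congr (_ *+ _).
  by apply: eq_card => o; rewrite inE.
(* [inord] loses nothing here because [#|P| <= n]. *)
rewrite big_mkord.
rewrite (partition_big (fun P : {set 'I_n} => inord #|P| : 'I_n.+1) xpredT) //=.
apply: eq_bigr => m _; rewrite big_distrr /= [RHS]big_mkcondr /=.
have cardE (P : {set 'I_n}) : (inord #|P| == m) = (#|P| == m :> nat).
  by rewrite -val_eqE /= inordK // ltnS -[leqRHS]card_ord max_card.
rewrite (eq_bigl _ _ cardE); apply: eq_bigr => P /eqP <-.
rewrite card_orientations_sources_sinks //.
by case: induced_bipartite; rewrite ?mul0n ?mulr0 // mul1n -!natz natrX.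
Qed.
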